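(* Let $k\in\{0,1,\dots,m-1\}$ and suppose the observation errors are uncorrelated, i.e. $\mathbf R_{k+1}$ (and hence $\mathbf R_k$) is diagonal. For $j\in\{k,k+1\}$ denote the eigenvalues of $\mathcal A_{2,j}$, of which $m$ are negative and $m$ are positive, by $$\lambda_{-m}(\mathcal A_{2,j})\le\dots\le\lambda_{-1}(\mathcal A_{2,j})<0<\lambda_1(\mathcal A_{2,j})\le\dots\le\lambda_m(\mathcal A_{2,j}).$$ Then, when the new observation is added, the smallest and largest negative eigenvalues of $\mathcal A_2$ move away from zero or are unchanged, and the smallest and largest positive eigenvalues of $\mathcal A_2$ approach zero or are unchanged; that is, $$\lambda_{i}(\mathcal A_{2,k+1})\le\lambda_{i}(\mathcal A_{2,k})\qquad\text{for } i\in\{-m,-1,1,m\}.$$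
   Context: Let $N,n\ge 1$ be integers and $m=(N+1)n$. Let $B,Q_1,\dots,Q_N\in\mathbb R^{n\times n}$ be symmetric positive definite and $M_0,\dots,M_{N-1}\in\mathbb R^{n\times n}$ arbitrary. Let $\mathbf D=\mathrm{diag}(B,Q_1,\dots,Q_N)\in\mathbb R^{m\times m}$ (block diagonal), and let $\mathbf L\in\mathbb R^{m\times m}$ be the block lower bidiagonal matrix with $n\times n$ identity blocks on the diagonal and blocks $-M_0,\dots,-M_{N-1}$ on the first block subdiagonal (all other blocks zero). A system with $k$ observations is described by a symmetric positive definite matrix $\mathbf R_k\in\mathbb R^{k\times k}$ and a matrix $\mathbf H_k\in\mathbb R^{k\times m}$ (both empty for $k=0$, with $\mathbf H_0^T\mathbf R_0^{-1}\mathbf H_0=\mathbf 0$). Adding one observation means passing to $$\mathbf R_{k+1}=\begin{pmatrix}\mathbf R_k& r\\ r^T&\alpha\end{pmatrix},\qquad \mathbf H_{k+1}=\begin{pmatrix}\mathbf H_k\\ h_{k+1}^T\end{pmatrix},$$ with $r\in\mathbb R^k$, $\alpha>0$, $h_{k+1}\in\mathbb R^m$ and $\mathbf R_{k+1}$ symmetric positive definite; $\mathbf D$ and $\mathbf L$ are unchanged. Define $$\mathcal A_{2,k}=\begin{pmatrix}\mathbf D&\mathbf L\\ \mathbf L^T&-\mathbf H_k^T\mathbf R_k^{-1}\mathbf H_k\end{pmatrix}\in\mathbb R^{2m\times 2m}.$$ *)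

(* Defs.v *)
From HB Require Import structures.
From mathcomp Require Import all_boot all_order all_algebra.
From mathcomp Require Import polyrcf.
From mathcomp Require Import reals.

Set Implicit Arguments.
Unset Strict Implicit.
Unset Printing Implicit Defensive.

Import Order.TTheory GRing.Theory Num.Theory.
Local Open Scope ring_scope.

Section Spectrum.
Variables (R : rcfType) (p : nat).
Implicit Types A : 'M[R]_p.

Definition spd A : Prop :=
  A^T = A /\ forall x : 'cV[R]_p, x != 0 -> 0 < (x^T *m A *m x) 0 0.

(* All real eigenvalues, repeated according to algebraic multiplicity. *)
Definition eigenvalues A : seq R :=
  sort <=%R (flatten [seq nseq (mup x (char_poly A)) x
                     | x <- rootsR (char_poly A)]).

Definition neg_eigenvalues A : seq R := [seq x <- eigenvalues A | x < 0].
Definition pos_eigenvalues A : seq R := [seq x <- eigenvalues A | 0 < x].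

(* Signed indexing outwards from zero: for i > 0, [lambda A i] is the i-th
   smallest positive eigenvalue and [lambda A (- i)] is the i-th largest
   negative one; recall that [Negz j] is - j.+1. The value is 0 if there is
   no such eigenvalue; [lambda A 0] is not used. *)
Definition lambda A (i : int) : R :=
  match i with
  | Posz j => nth 0 (pos_eigenvalues A) j.-1
  | Negz j => nth 0 (rev (neg_eigenvalues A)) j
  end.

End Spectrum.

(* The dimension (N + 1) n, in the form in which it arises as the size of an
   (N + 1) x (N + 1) array of n x n blocks. *)
Definition bdim (N n : nat) : nat := \sum_(i < N.+1) n.

Lemma bdimE N n : bdim N n = (N.+1 * n)%N.
Proof. by rewrite /bdim sum_nat_const card_ord. Qed.

Section Blocks.
Variables (R : rcfType) (N n : nat).

(* diag(B, Q_1, ..., Q_N), where [Q l] stands for Q_(l+1). *)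
Definition Dmx (B : 'M[R]_n) (Q : 'I_N -> 'M[R]_n) : 'M[R]_(bdim N n) :=
  \mxdiag_(i < N.+1) (if unlift ord0 i is Some l then Q l else B).

(* [unlift ord0 i = Some l] means i = l + 1: the block at (l + 1, l)
   is - M_l. *)
Definition Lmx (M : 'I_N -> 'M[R]_n) : 'M[R]_(bdim N n) :=
  \mxblock_(i < N.+1, j < N.+1)
    (if i == j then 1%:M
     else if unlift ord0 i is Some l then
       if j == l :> nat then - M l else 0
     else 0).

Definition A2mx (m k : nat) (D L : 'M[R]_m) (Rk : 'M[R]_k) (Hk : 'M[R]_(k, m)) :
    'M[R]_(m + m) :=
  block_mx D L L^T (- (Hk^T *m invmx Rk *m Hk)).

Definition extendR (k : nat) (Rk : 'M[R]_k) (r : 'cV[R]_k) (alpha : R) :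
    'M[R]_(k + 1) :=
  block_mx Rk r r^T alpha%:M.

Definition extendH (m k : nat) (Hk : 'M[R]_(k, m)) (h : 'cV[R]_m) :
    'M[R]_(k + 1, m) :=
  col_mx Hk h^T.

End Blocks.

(* Main.v *)
Require Import Defs.
From HB Require Import structures.
From mathcomp Require Import all_boot all_order all_algebra.
From mathcomp Require Import reals.
From mathcomp Require Import polyrcf complex.

(* For diagonal R_{k+1}, A_{2,k+1} = A_{2,k} - diag(0, h h^T / alpha) differs
   from A_{2,k} by a positive semidefinite matrix, so by Weyl's monotonicity
   every eigenvalue, counted in increasing order, weakly decreases.  The inertia
   (m, m) turns this into the inequality for each signed index: the form is
   positive on R^m x 0 and negative on the vectors (- D^-1 L y, y).  Eigenvalues
   are counted by intersecting subspaces with spans of eigenvectors. *)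

Set Implicit Arguments.
Unset Strict Implicit.
Unset Printing Implicit Defensive.

Import Order.TTheory GRing.Theory Num.Theory.
Local Open Scope ring_scope.

(** * Real diagonalization of symmetric matrices; the spectrum as a multiset *)

Section Diagonalization.
Variables (R : rcfType) (p : nat).
Implicit Types (A P : 'M[R]_p) (d : 'rV[R]_p).

(** The spectral theorem over [R[i]] gives a unitary diagonalization with real eigenvalues. Real
    matrices similar over [R[i]] are similar through a real matrix, but unitarity may be lost on the
    way: [P] is only known to be invertible. Its rows are left eigenvectors. *)
Lemma symmetric_diagonalizable A : A^T = A ->
  exists2 P, P \in unitmx & exists d, P *m A = diag_mx d *m P.
Proof.
move=> Asym; pose c := @real_complex R; pose Ac := map_mx c A.
have real_c (x : R) : c x \is Num.real by apply/complex_realP; exists x.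
have Ac_real : Ac \is a mxOver Num.real by apply/mxOverP => i j; rewrite mxE.
have Ac_sym : Ac \is symmetricmx.
  by apply/is_hermitianmxP; rewrite expr0 scale1r map_mx_id // map_trmx Asym.
have Ac_herm := realsym_hermsym Ac_sym Ac_real.
have /orthomx_spectralP AcE := hermitian_normalmx Ac_herm.
have d_real := hermitian_spectral_diag_real Ac_herm.
have [] := @real_similar _ _ Ac (diag_mx (spectral_diag Ac)).
- exists (spectralmx Ac); first exact: spectral_unit.
  apply/similarP; first exact: spectral_unit.
  by rewrite {2}AcE !mulmxA mulmxV ?spectral_unit ?mul1mx.
- exact: Ac_real.
- apply/mxOverP => i j; rewrite !mxE; case: (i == j) => /=; last by rewrite mulr0n real0.
  by rewrite mulr1n; apply/mxOverP.
move=> P; rewrite inE => /andP[P_real P_unit] /(similarP P_unit) PA.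
have map_Re m n (M : 'M[R[i]]_(m, n)) : M \is a mxOver Num.real ->
    M = map_mx c (map_mx (@complex.Re R) M).
  move=> /mxOverP Mr; apply/matrixP => i j; rewrite !mxE.
  by have /complex_realP[x ->] := Mr i j.
have PE := map_Re _ _ _ P_real; have dE := map_Re _ _ _ d_real.
exists (map_mx (@complex.Re R) P); first by rewrite -(map_unitmx c) -PE.
exists (map_mx (@complex.Re R) (spectral_diag Ac)).
apply: (@map_mx_inj _ _ c).
by rewrite !map_mxM map_diag_mx -PE -dE.
Qed.

Lemma char_poly_similar A B P : P \in unitmx -> P *m A = B *m P ->
  char_poly A = char_poly B.
Proof.
move=> Pu PA; rewrite /char_poly /char_poly_mx.
have dP0 : \det (map_mx polyC P) != 0.
  by rewrite det_map_mx polyC_eq0 -unitfE -unitmxE.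
apply: (mulfI dP0); rewrite -det_mulmx [RHS]mulrC -det_mulmx.
by rewrite mulmxBl mulmxBr -!map_mxM PA scalar_mxC.
Qed.

Lemma mup_prod_XsubC (s : seq R) x : mup x (\prod_(y <- s) ('X - y%:P)) = count_mem x s.
Proof.
elim: s => [|y s IHs]; first by rewrite big_nil mupNroot ?root1.
rewrite big_cons mupM ?polyXsubC_eq0 ?monic_neq0 ?monic_prod_XsubC //= IHs.
by rewrite -['X - _]expr1 mup_XsubCX; case: (y == x).
Qed.

(** On both sides a value [x] occurs [mup x (char_poly A)] times, because [rootsR] lists each root
    exactly once. *)
Lemma perm_eigenvalues A (s : seq R) : char_poly A = \prod_(y <- s) ('X - y%:P) ->
  perm_eq (eigenvalues A) s.
Proof.
move=> AE; rewrite /eigenvalues perm_sort; set q := char_poly A in AE *.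
have q0 : q != 0 by rewrite AE monic_neq0 // monic_prod_XsubC.
apply/allP => x _; apply/eqP.
rewrite -[RHS]mup_prod_XsubC -AE count_flatten sumnE !big_map.
have xE : root q x = (x \in rootsR q) by have := roots_on_rootsR q0 x; rewrite in_itv.
under eq_bigr => y _ do rewrite count_nseq /=.
have [rx|nrx] := boolP (root q x); last first.
  rewrite mupNroot // big_seq big1 // => y; have [->|] := eqVneq y x => //.
  by rewrite -xE (negPf nrx).
rewrite (bigD1_seq x) -?xE ?uniq_roots //= eqxx mul1n big1 ?addn0 // => y.
by move=> /negPf->.
Qed.

Lemma perm_eigenvalues_diag A P d : P \in unitmx -> P *m A = diag_mx d *m P ->
  perm_eq (eigenvalues A) [seq d 0 i | i : 'I_p].
Proof.
move=> Pu PA; apply: perm_eigenvalues; rewrite (char_poly_similar Pu PA).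
rewrite char_poly_trig ?diag_mx_is_trig // big_map big_enum /=.
by apply: eq_bigr => i _; rewrite !mxE eqxx.
Qed.

End Diagonalization.

(** * Quadratic forms and positive definiteness *)

Section QuadraticForm.
Variable R : rcfType.

(** Vectors are rows here, unlike in [spd], so that subspaces can be given as row spaces. *)
Definition qform p (A : 'M[R]_p) (u : 'rV[R]_p) : R := (u *m A *m u^T) 0 0.

Lemma qformD p (A B : 'M[R]_p) u : qform (A + B) u = qform A u + qform B u.
Proof. by rewrite /qform mulmxDr mulmxDl mxE. Qed.

Lemma qformN p (A : 'M[R]_p) u : qform (- A) u = - qform A u.
Proof. by rewrite /qform mulmxN mulNmx mxE. Qed.

Lemma qform_scalar p (t : R) (u : 'rV[R]_p) : qform t%:M u = t * qform 1%:M u.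
Proof. by rewrite /qform mul_mx_scalar mulmx1 -scalemxAl mxE. Qed.

Lemma qform_conj p q (M : 'M[R]_(p, q)) (A : 'M[R]_q) u :
  qform (M *m A *m M^T) u = qform A (u *m M).
Proof. by rewrite /qform trmx_mul !mulmxA. Qed.

Lemma qform1E p (u : 'rV[R]_p) : qform 1%:M u = \sum_i u 0 i ^+ 2.
Proof. by rewrite /qform mulmx1 mxE; apply: eq_bigr => i _; rewrite mxE. Qed.

Lemma qform1_ge0 p (u : 'rV[R]_p) : 0 <= qform 1%:M u.
Proof. by rewrite qform1E sumr_ge0 // => i _; rewrite sqr_ge0. Qed.

Lemma qform1_gt0 p (u : 'rV[R]_p) : u != 0 -> 0 < qform 1%:M u.
Proof.
rewrite lt_def qform1_ge0 andbT; apply: contra_neq.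
rewrite qform1E => /psumr_eq0P u0; apply/rowP => i; rewrite mxE.
by apply/eqP; rewrite -sqrf_eq0 u0 // => j _; rewrite sqr_ge0.
Qed.

Lemma spd_qform_gt0 p (A : 'M[R]_p) u : spd A -> u != 0 -> 0 < qform A u.
Proof.
by case=> _ Apos u0; have := Apos u^T; rewrite trmxK -trmx0 (inj_eq trmx_inj); apply.
Qed.

Lemma spd_qform_ge0 p (A : 'M[R]_p) u : spd A -> 0 <= qform A u.
Proof.
move=> Aspd; have [->|u0] := eqVneq u 0; last by rewrite ltW // spd_qform_gt0.
by rewrite /qform !mul0mx mxE.
Qed.

Lemma spd_unitmx p (A : 'M[R]_p) : spd A -> A \in unitmx.
Proof.
move=> Aspd; rewrite -row_free_unit; apply: inj_row_free => v vA.
apply/eqP/negPn/negP => /(spd_qform_gt0 Aspd).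
by rewrite /qform vA mul0mx mxE ltxx.
Qed.

Lemma spd_invmx p (A : 'M[R]_p) : spd A -> spd (invmx A).
Proof.
move=> Aspd; have Au := spd_unitmx Aspd; have [Asym _] := Aspd.
have Vsym : (invmx A)^T = invmx A by rewrite trmx_inv Asym.
split=> // x x0.
have -> : x^T *m invmx A *m x = (x^T *m invmx A) *m A *m (x^T *m invmx A)^T.
  by rewrite trmx_mul trmxK Vsym !mulmxA mulmxKV.
apply: (spd_qform_gt0 Aspd); apply: contra_neq x0 => xV0.
by rewrite -[x]trmxK -[x^T](mulmxKV Au) xV0 mul0mx trmx0.
Qed.

(** * Forms on spans of eigenvectors, and dimension counts *)

Section Counting.
Variables (p : nat) (A P : 'M[R]_p) (d : 'rV[R]_p).
Hypotheses (Asym : A^T = A) (Pu : P \in unitmx) (PA : P *m A = diag_mx d *m P).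

(* [P] need not be orthogonal, but its Gram matrix [P P^T] commutes with the
   eigenvalue matrix, hence with every function of it. *)
Lemma gram_comm (f : R -> R) :
  diag_mx (map_mx f d) *m (P *m P^T) = (P *m P^T) *m diag_mx (map_mx f d).
Proof.
have comm : diag_mx d *m (P *m P^T) = (P *m P^T) *m diag_mx d.
  have PAt : P^T *m diag_mx d = A *m P^T.
    by rewrite -[in RHS]Asym -trmx_mul PA trmx_mul tr_diag_mx.
  by rewrite mulmxA -PA -!mulmxA PAt.
apply/matrixP => i j; rewrite mul_diag_mx mul_mx_diag !mxE.
have /matrixP/(_ i j) := comm; rewrite mul_diag_mx mul_mx_diag !mxE.
set g := \sum_k _; have [->|g0] := eqVneq g 0; first by rewrite !mulr0 !mul0r.
by rewrite mulrC => /(mulfI g0) ->; rewrite mulrC.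
Qed.

(** With G = P P^T and Delta = [diag_mx d], the left side is w (Delta - t) G w^T. On the support of
    [w], Delta - t is the square of the diagonal matrix S of square roots, and S commutes with G, so
    this equals (w S) G (w S)^T. *)
Lemma qform_support t (w : 'rV[R]_p) : (forall i, w 0 i != 0 -> t <= d 0 i) ->
  qform A (w *m P) - t * qform 1%:M (w *m P) =
  qform 1%:M (w *m diag_mx (map_mx (fun x => Num.sqrt (x - t)) d) *m P).
Proof.
move=> ht; set S := diag_mx _.
rewrite -qform_scalar -qformN -qformD -qform_conj -[in RHS]mulmxA -[in RHS]qform_conj.
rewrite mulmxBr mulmxBl PA scalar_mxC mulmx1 trmx_mul tr_diag_mx -/S.
rewrite -[S *m P *m _]mulmxA [P *m (_ *m S)]mulmxA -gram_comm -/S.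
rewrite -[diag_mx d *m P *m _]mulmxA -[t%:M *m P *m _]mulmxA -mulmxBl mulmxA.
rewrite /qform !mulmxA; congr ((_ *m _ *m _ *m _) 0 0).
rewrite -!mulmxA mulmx_diag; apply/rowP => i.
rewrite mulmxBr mul_mx_scalar !mul_mx_diag !mxE.
(* Off the support [d 0 i - t] may be negative and differ from its squared root, but the factor
   [w 0 i] vanishes. *)
have [->|/ht le_t] := eqVneq (w 0 i) 0; first by rewrite !mul0r mulr0 subrr.
by rewrite -expr2 sqr_sqrtr ?subr_ge0 // mulrBr [t * _]mulrC.
Qed.

Lemma qform_ge_support t (w : 'rV[R]_p) : (forall i, w 0 i != 0 -> t <= d 0 i) ->
  t * qform 1%:M (w *m P) <= qform A (w *m P).
Proof. by move=> ht; rewrite -subr_ge0 qform_support // qform1_ge0. Qed.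

Lemma qform_gt_support t (w : 'rV[R]_p) : (forall i, w 0 i != 0 -> t < d 0 i) ->
  w != 0 -> t * qform 1%:M (w *m P) < qform A (w *m P).
Proof.
move=> ht w0; rewrite -subr_gt0 qform_support => [|i /ht/ltW //].
apply: qform1_gt0; apply: contra_neq w0 => wSP0; apply/rowP => i; rewrite !mxE.
have /rowP/(_ i) : w *m diag_mx (map_mx (fun x => Num.sqrt (x - t)) d) = 0.
  by rewrite -[LHS](mulmxK Pu) wSP0 mul0mx.
rewrite mul_mx_diag !mxE => /eqP; rewrite mulf_eq0 => /orP[/eqP //|].
have [-> //|/ht t_lt] := eqVneq (w 0 i) 0.
by rewrite sqrtr_eq0 subr_le0 leNgt t_lt.
Qed.

(** Expand the rows of [U] in the basis formed by the rows of [P] and keep the coordinates in [I]. A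
    combination killed by this projection lies in [U] and in the span of the rows of [P] outside
    [I], hence is 0; so the projection is injective into dimension [#|I|]. *)
Lemma row_free_rank_le_card q (U : 'M[R]_(q, p)) (I : {pred 'I_p}) : row_free U ->
    (forall w : 'rV[R]_p, (forall i, w 0 i != 0 -> i \notin I) ->
       (w *m P <= U)%MS -> w = 0) ->
  (q <= #|I|)%N.
Proof.
move=> Ufree Udisj; pose f (i : 'I_#|I|) := enum_val i.
have : row_free (colsub f (U *m invmx P)).
  apply: inj_row_free => y; rewrite mulmx_colsub => /rowP y0.
  have yUE : y *m (U *m invmx P) *m P = y *m U by rewrite mulmxA mulmxKV.
  have /Udisj : forall i, (y *m (U *m invmx P)) 0 i != 0 -> i \notin I.
    move=> i; apply: contraNN => Ii.
    by have := y0 (enum_rank_in Ii i); rewrite !mxE /f enum_rankK_in // => ->.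
  rewrite yUE submxMl => /(_ isT) yUP0; apply: (row_free_inj Ufree).
  by rewrite /= mul0mx -yUE yUP0 mul0mx.
by move=> /eqP <-; exact: rank_leq_col.
Qed.

Lemma count_eigenvalues (a : pred R) :
  count a (eigenvalues A) = #|[pred i | a (d 0 i)]|.
Proof.
rewrite (permP (perm_eigenvalues_diag Pu PA)) count_map.
by rewrite -sum1_count big_enum_cond -sum1_card; apply: eq_bigl => i; rewrite !inE.
Qed.

End Counting.

(** * Eigenvalue counts from subspaces, and Weyl monotonicity *)

Section EigenvalueCount.
Variables (p : nat) (A : 'M[R]_p).
Hypothesis Asym : A^T = A.

Lemma size_eigenvalues : size (eigenvalues A) = p.
Proof.
have [P Pu [d PA]] := symmetric_diagonalizable Asym.
by rewrite (perm_size (perm_eigenvalues_diag Pu PA)) size_map -cardE card_ord.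
Qed.

Variables (q : nat) (U : 'M[R]_(q, p)) (t : R).
Hypothesis Ufree : row_free U.

(** [U] meets the span of the eigenvectors with eigenvalue at most [t] only in 0, since there the
    form is at most [t] times the squared norm. *)
Lemma eigenvalues_count_gt :
    (forall u, (u <= U)%MS -> u != 0 -> t * qform 1%:M u < qform A u) ->
  (q <= count (> t) (eigenvalues A))%N.
Proof.
have [P Pu [d PA]] := symmetric_diagonalizable Asym.
have Nsym : (- A)^T = - A by rewrite linearN /= Asym.
(* [qform_ge_support] bounds from below; the upper bound comes from [- A], diagonalized by the same
   [P]. *)
have NPA : P *m - A = diag_mx (- d) *m P by rewrite mulmxN PA linearN mulNmx.
move=> UA; rewrite (count_eigenvalues Pu PA).
apply: (row_free_rank_le_card Pu Ufree) => w wI wU.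
apply/eqP/negPn/negP => w0.
have wP0 : w *m P != 0.
  by apply: contra_neq w0 => wP0; rewrite -[w](mulmxK Pu) wP0 mul0mx.
have := UA _ wU wP0; apply/negP; rewrite -leNgt -lerN2 -qformN -mulNr.
apply: (qform_ge_support Nsym NPA) => i /wI.
by rewrite inE -leNgt mxE lerN2.
Qed.

Lemma eigenvalues_count_lt :
    (forall u, (u <= U)%MS -> u != 0 -> qform A u < t * qform 1%:M u) ->
  (q <= count (< t) (eigenvalues A))%N.
Proof.
have [P Pu [d PA]] := symmetric_diagonalizable Asym.
move=> UA; rewrite (count_eigenvalues Pu PA).
apply: (row_free_rank_le_card Pu Ufree) => w wI wU.
apply/eqP/negPn/negP => w0.
have wP0 : w *m P != 0.
  by apply: contra_neq w0 => wP0; rewrite -[w](mulmxK Pu) wP0 mul0mx.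
have := UA _ wU wP0; apply/negP; rewrite -leNgt.
by apply: (qform_ge_support Asym PA) => i /wI; rewrite inE -leNgt.
Qed.

(** As the bound on [U] is weak, strictness must come from the eigenvectors with eigenvalue above
    [t], through [qform_gt_support]. *)
Lemma eigenvalues_count_le :
    (forall u, (u <= U)%MS -> qform A u <= t * qform 1%:M u) ->
  (q <= count (<= t) (eigenvalues A))%N.
Proof.
have [P Pu [d PA]] := symmetric_diagonalizable Asym.
move=> UA; rewrite (count_eigenvalues Pu PA).
apply: (row_free_rank_le_card Pu Ufree) => w wI wU.
apply/eqP/negPn/negP => w0; have := UA _ wU; apply/negP; rewrite -ltNge.
by apply: (qform_gt_support Asym Pu PA) w0 => i /wI; rewrite inE -ltNge.
Qed.

End EigenvalueCount.

(** Let [U] be spanned by the eigenvectors of [A] with eigenvalue at most [t]. On it the form of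
    [A], hence that of [B], is at most [t] times the squared norm, so [B] has at least dim [U]
    eigenvalues up to [t]. *)
Lemma count_eigenvalues_mono p (A B : 'M[R]_p) t : A^T = A -> B^T = B ->
    (forall u, qform B u <= qform A u) ->
  (count (<= t) (eigenvalues A) <= count (<= t) (eigenvalues B))%N.
Proof.
move=> Asym Bsym BA; have [P Pu [d PA]] := symmetric_diagonalizable Asym.
have Nsym : (- A)^T = - A by rewrite linearN /= Asym.
have NPA : P *m - A = diag_mx (- d) *m P by rewrite mulmxN PA linearN mulNmx.
rewrite (count_eigenvalues Pu PA); set I := [pred i | _].
pose f (i : 'I_#|I|) := enum_val i.
apply: (@eigenvalues_count_le _ _ Bsym _ (rowsub f P)) => [|_ /submxP[y ->]].
  apply: inj_row_free => y; rewrite rowsubE mulmxA => yP0.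
  have /rowP y0 : y *m rowsub f 1%:M = 0 by rewrite -[LHS](mulmxK Pu) yP0 mul0mx.
  apply/rowP => j; have := y0 (f j); rewrite !mxE (bigD1 j) //= !mxE eqxx mulr1.
  rewrite big1 ?addr0 // => i /negPf ij.
  by rewrite !mxE (inj_eq enum_val_inj) ij mulr0.
rewrite rowsubE mulmxA; apply: le_trans (BA _) _.
rewrite -lerN2 -qformN -mulNr; apply: (qform_ge_support Nsym NPA) => i.
(* The coordinate vector [y *m rowsub f 1%:M] is [y] extended by 0 outside [I]. *)
rewrite !mxE lerN2; apply: contraR => it; rewrite big1 // => j _.
rewrite !mxE; case: eqP => [fj|_]; last by rewrite mulr0.
have : f j \in I := enum_valP j.
by rewrite fj inE /= (negPf it).
Qed.

(** Taking [t] to be entry [i] of the spectrum of [A], more than [i] eigenvalues of [A] are at most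
    [t], hence more than [i] of those of [B]. *)
Lemma nth_eigenvalues_mono p (A B : 'M[R]_p) i : A^T = A -> B^T = B ->
    (forall u, qform B u <= qform A u) ->
  nth 0 (eigenvalues B) i <= nth 0 (eigenvalues A) i.
Proof.
move=> Asym Bsym BA; have sorted_ev (C : 'M[R]_p) : sorted <=%R (eigenvalues C).
  exact: sort_le_sorted.
have [ip|pi] := ltnP i p; last by rewrite !nth_default ?size_eigenvalues.
apply: nth_count_le => //; apply: leq_trans (count_eigenvalues_mono _ Asym Bsym BA).
rewrite ltnNge; apply/negP => le_i.
suff: nth 0 (eigenvalues A) i < nth 0 (eigenvalues A) i by rewrite ltxx.
by apply: nth_count_gt => //; rewrite le_i size_eigenvalues.
Qed.

End QuadraticForm.

(** * The saddle point matrix: inertia, signed indices, new observation *)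

Section SaddlePoint.
Variable R : rcfType.

Lemma spd_Dmx N n (B : 'M[R]_n) (Q : 'I_N -> 'M[R]_n) :
  spd B -> (forall l, spd (Q l)) -> spd (Dmx B Q).
Proof.
move=> Bspd Qspd; rewrite /Dmx.
pose F (i : 'I_N.+1) : 'M[R]_n := if unlift ord0 i is Some l then Q l else B.
have Fspd i : spd (F i) by rewrite /F; case: (unlift ord0 i).
split=> [|x x0].
  by rewrite tr_mxdiag; apply: eq_mxdiag => i; case: (Fspd i).
have -> : x = \mxcol_i submxcol x i by rewrite submxcolK.
rewrite -mulmxA mul_mxdiag_mxcol tr_mxcol mul_mxrow_mxcol summxE.
have Fge0 (i : 'I_N.+1) : 0 <= ((submxcol x i)^T *m (F i *m submxcol x i)) 0 0.
  by have := spd_qform_ge0 (submxcol x i)^T (Fspd i); rewrite /qform trmxK mulmxA.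
rewrite lt_def sumr_ge0 ?andbT //; apply: contra_neq x0.
move=> /psumr_eq0P x0; rewrite -[x]submxcolK; apply/eqP; rewrite -mxcol0.
apply/eqP/eq_mxcol => i; apply/eqP/negPn/negP => xi0.
by have := (Fspd i).2 _ xi0; rewrite -mulmxA x0 ?ltxx.
Qed.

Lemma Lmx_unitmx N n (M : 'I_N -> 'M[R]_n) : Lmx M \in unitmx.
Proof.
rewrite unitmxE det_trig.
  rewrite big1 ?unitr1 // => i _; rewrite !mxE eqxx.
  by rewrite mxE eqxx.
apply/is_trig_mxblockP; split=> [i j ij|i]; last by rewrite eqxx scalar_mx_is_trig.
rewrite -val_eqE (ltn_eqF ij); case: unliftP => [l il|//].
(* Here i = l + 1 < j, so column [j] is not the subdiagonal column [l]. *)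
by rewrite gtn_eqF //; move: ij; rewrite il /= /bump /=; exact: ltnW.
Qed.

Lemma saddle_inertia m (D L S : 'M[R]_m) : spd D -> L \in unitmx ->
    S^T = S -> (forall u, 0 <= qform S u) ->
  let A := block_mx D L L^T (- S) in
  [/\ A^T = A, size (neg_eigenvalues A) = m & size (pos_eigenvalues A) = m].
Proof.
move=> Dspd Lu Ssym Sge0 A; have [Dsym _] := Dspd; have Du := spd_unitmx Dspd.
have Asym : A^T = A by rewrite tr_block_mx trmxK Dsym linearN /= Ssym.
have pos : (m <= count (> 0%R) (eigenvalues A))%N.
  apply: (@eigenvalues_count_gt _ _ _ Asym _ (row_mx 1%:M 0)).
    apply: inj_row_free => y.
    by rewrite mul_mx_row mulmx1 -row_mx0 => /eq_row_mx[].
  move=> _ /submxP[y ->]; rewrite mul_mx_row mulmx1 mulmx0 mul0r => u0.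
  have -> : qform A (row_mx y 0) = qform D y.
    by rewrite /qform mul_row_block tr_row_mx mul_row_col trmx0 mulmx0
      !mul0mx !addr0.
  by apply: spd_qform_gt0 => //; apply: contra_neq u0 => ->; rewrite row_mx0.
have neg : (m <= count (< 0%R) (eigenvalues A))%N.
  apply: (@eigenvalues_count_lt _ _ _ Asym _ (row_mx (- (L^T *m invmx D)) 1%:M)).
    apply: inj_row_free => y.
    by rewrite mul_mx_row mulmx1 -row_mx0 => /eq_row_mx[].
  move=> _ /submxP[y ->]; rewrite mul_mx_row mulmx1 mul0r => u0.
  have y0 : y != 0 by apply: contra_neq u0 => ->; rewrite mul0mx row_mx0.
  rewrite mulmxN mulmxA; set z := y *m L^T *m invmx D.
  have zD : z *m D = y *m L^T by rewrite mulmxKV.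
  (* Invertibility of [L] makes [qform D z] strictly positive, which is essential because [S] is
     only semidefinite. *)
  have z0 : z != 0.
    apply: contra_neq y0 => z0; rewrite -[y](@mulmxK _ _ _ L^T) ?unitmx_tr //.
    by rewrite -zD z0 !mul0mx.
  have -> : qform A (row_mx (- z) y) = - (qform D z + qform S y).
    have zL : z *m L *m y^T = z *m D *m z^T.
      by rewrite -!mulmxA -[L]trmxK -trmx_mul -zD trmx_mul Dsym.
    rewrite /qform -zL mul_row_block !mulNmx zD addNr tr_row_mx mul_row_col.
    rewrite mul0mx add0r mulmxN -opprD mulNmx mulmxDl.
    by rewrite [LHS]mxE [X in - X = _]mxE.
  by rewrite oppr_lt0 ltr_wpDr // spd_qform_gt0.
(* There are 2m eigenvalues in all, so both lower bounds [m] are attained. *)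
have tot : (count (< 0%R) (eigenvalues A) + count (> 0%R) (eigenvalues A) <= m + m)%N.
  rewrite -[leqRHS](size_eigenvalues Asym) -(count_predC (< 0%R)) leq_add2l.
  by apply: sub_count => x /= x0; rewrite -leNgt ltW.
split=> //; rewrite size_filter; apply/eqP; rewrite eqn_leq ?neg ?pos andbT.
  by rewrite -(leq_add2r m) (leq_trans _ tot) // leq_add2l.
by rewrite -(leq_add2l m) (leq_trans _ tot) // leq_add2r.
Qed.

(** With [m] eigenvalues of each sign, a signed index is the same position in both sorted spectra:
    [m + j] on the positive side, [m - j.+1] on the negative side, with [j] counted from 0. *)
Lemma lambda_mono m (A B : 'M[R]_(m + m)) i : A^T = A -> B^T = B ->
    size (neg_eigenvalues A) = m -> size (pos_eigenvalues A) = m ->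
    size (neg_eigenvalues B) = m -> size (pos_eigenvalues B) = m ->
    (forall u, qform B u <= qform A u) ->
  lambda B i <= lambda A i.
Proof.
have sorted_ev (C : 'M[R]_(m + m)) : sorted <=%R (eigenvalues C).
  exact: sort_le_sorted.
have posE (C : 'M[R]_(m + m)) j : C^T = C -> size (pos_eigenvalues C) = m ->
    nth 0 (pos_eigenvalues C) j = nth 0 (eigenvalues C) (m + j).
  move=> Csym; rewrite /pos_eigenvalues sorted_filter_gt // nth_drop size_drop.
  rewrite size_eigenvalues // => Cm.
  have le2m : (count (<= 0%R) (eigenvalues C) <= m + m)%N.
    by rewrite -[leqRHS](size_eigenvalues Csym) count_size.
  by congr (nth _ _ (_ + _)); apply/eqP; rewrite -(eqn_add2l m) -{1}Cm subnK.
have negE (C : 'M[R]_(m + m)) j : size (neg_eigenvalues C) = m -> (j < m)%N ->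
    nth 0 (rev (neg_eigenvalues C)) j = nth 0 (eigenvalues C) (m - j.+1).
  move=> Cm jm; rewrite nth_rev Cm //; move: Cm.
  rewrite /neg_eigenvalues sorted_filter_lt // size_takel ?count_size // => ->.
  by rewrite nth_take // ltn_subrL ltnS (leq_ltn_trans _ jm).
move=> Asym Bsym An Ap Bn Bp BA; case: i => j /=.
  by rewrite !posE //; apply: nth_eigenvalues_mono.
(* Past [m] the truncated difference [m - j.+1] is no longer the right position, but both sides are
   then the default 0. *)
have [jm|mj] := ltnP j m; last by rewrite !nth_default ?size_rev ?An ?Bn.
by rewrite !negE //; apply: nth_eigenvalues_mono.
Qed.

Lemma A2mx_inertia m k (D L : 'M[R]_m) (Rk : 'M[R]_k) (Hk : 'M[R]_(k, m)) :
    spd D -> L \in unitmx -> spd Rk ->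
  let A := A2mx D L Rk Hk in
  [/\ A^T = A, size (neg_eigenvalues A) = m & size (pos_eigenvalues A) = m].
Proof.
move=> Dspd Lu Rspd; have Vspd := spd_invmx Rspd; apply: saddle_inertia => //.
  by rewrite !trmx_mul trmxK Vspd.1 mulmxA.
move=> u; have := qform_conj Hk^T (invmx Rk) u; rewrite trmxK => ->.
exact: spd_qform_ge0.
Qed.

Lemma qform_A2mx_extend m k (D L : 'M[R]_m) (Rk : 'M[R]_k) (Hk : 'M[R]_(k, m))
    r alpha h (u : 'rV[R]_(m + m)) :
    0 < alpha -> spd Rk -> is_diag_mx (extendR Rk r alpha) ->
  qform (A2mx D L (extendR Rk r alpha) (extendH Hk h)) u <= qform (A2mx D L Rk Hk) u.
Proof.
(* Diagonality gives [r] = 0, so the inverse is block diagonal and the new observation contributes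
   exactly one rank-one term. *)
move=> a0 Rspd; rewrite is_diag_block_mx // => /andP[/eqP r0 _].
have -> : A2mx D L (extendR Rk r alpha) (extendH Hk h) =
    A2mx D L Rk Hk - block_mx 0 0 0 (alpha^-1 *: (h *m h^T)).
  rewrite /A2mx /extendR /extendH r0 trmx0 invmx_block_diag; last first.
    by rewrite block_diag_mx_unit spd_unitmx // unitmxE det_scalar1 unitfE gt_eqF.
  rewrite tr_col_mx trmxK mul_row_block mul_row_col !mulmx0 addr0 add0r.
  rewrite opp_block_mx add_block_mx !oppr0 !addr0 -opprD invmx_scalar.
  by rewrite mul_mx_scalar scalemxAl.
rewrite qformD qformN gerDl oppr_le0 -[u]hsubmxK.
(* The rank-one form is a square: [rsubmx v *m h] is a 1 x 1 matrix. *)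
have -> v : qform (block_mx 0 0 0 (alpha^-1 *: (h *m h^T)))
      (row_mx (lsubmx v) (rsubmx v)) =
    alpha^-1 * qform 1%:M (rsubmx v *m h).
  rewrite -qform_conj mulmx1 /qform mul_row_block tr_row_mx mul_row_col.
  by rewrite !mulmx0 !add0r mul0mx add0r -scalemxAr -scalemxAl mxE.
by rewrite mulr_ge0 ?qform1_ge0 // invr_ge0 ltW.
Qed.

End SaddlePoint.

Theorem theorem5 (R : realType) (N n : nat) (hN : (1 <= N)%N) (hn : (1 <= n)%N)
    (B : 'M[R]_n) (Q M : 'I_N -> 'M[R]_n)
    (hB : spd B) (hQ : forall l, spd (Q l))
    (k : nat) (hk : (k < bdim N n)%N)
    (Rk : 'M[R]_k) (Hk : 'M[R]_(k, bdim N n)) (hRk : spd Rk)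
    (r : 'cV[R]_k) (alpha : R) (h : 'cV[R]_(bdim N n))
    (halpha : 0 < alpha) (hRk1 : spd (extendR Rk r alpha))
    (hdiag : is_diag_mx (extendR Rk r alpha)) :
  let m := bdim N n in
  let Ak := A2mx (Dmx B Q) (Lmx M) Rk Hk in
  let Ak1 := A2mx (Dmx B Q) (Lmx M) (extendR Rk r alpha) (extendH Hk h) in
  [/\ size (neg_eigenvalues Ak) = m /\ size (pos_eigenvalues Ak) = m,
      size (neg_eigenvalues Ak1) = m /\ size (pos_eigenvalues Ak1) = m
    & forall i : int, i \in [:: - m%:Z; -1; 1; m%:Z] ->
        lambda Ak1 i <= lambda Ak i].
Proof.
move=> m Ak Ak1; have Dspd := spd_Dmx hB hQ; have Lu := Lmx_unitmx M.
have [Asym An Ap] := A2mx_inertia Hk Dspd Lu hRk.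
have [A1sym A1n A1p] := A2mx_inertia (extendH Hk h) Dspd Lu hRk1.
split; [exact: conj An Ap | exact: conj A1n A1p | move=> i _].
apply: (lambda_mono i Asym A1sym An Ap A1n A1p) => u.
exact: qform_A2mx_extend halpha hRk hdiag.
Qed.
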